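(* There is no circulant weighing matrix of order $60$ and weight $36$; equivalently, there is no sequence $[a_0,\dots,a_{59}]$ with entries in $\{0,\pm1\}$, exactly $36$ nonzero entries, and $\sum_{i=0}^{59}a_ia_{i+s}=0$ for all $s=1,\dots,59$ (indices mod 60).
   Context: A weighing matrix of order $n$ and weight $w>0$ is an $n\times n$ matrix $W$ with entries in $\{0,\pm1\}$ such that $WW^T=wI$. A circulant matrix is one in which each row is the cyclic shift by one position to the right of the previous row. *)

(* Defs.v *)
From HB Require Import structures.
From mathcomp Require Import all_boot all_order all_algebra.
Set Implicit Arguments. Unset Strict Implicit. Unset Printing Implicit Defensive.
Import Order.TTheory GRing.Theory Num.Theory.
Local Open Scope ring_scope.

Definition weighing_matrix (n w : nat) (W : 'M[int]_n) : Prop :=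
  (0 < w)%N /\
  (forall i j, W i j \in [:: 0; 1; -1]) /\
  W *m W^T = (w%:R : int)%:M.

Definition circulant (n : nat) (W : 'M[int]_n.+1) : Prop :=
  forall (i j : 'I_n.+1), (i < n)%N ->
    W (inord i.+1) (inord (j.+1 %% n.+1)) = W i j.

(* Main.v *)
(* Let [a] be the first row. Identify [Z/60] with [Z/20 * Z/3] and let [b], [c] be the
   sums and differences of [a] over the cosets of the subgroup of order 2: they
   live on [Z/10 * Z/3], cyclically and negacyclically, and both have
   autocorrelation [36 delta]. Let [D], [F] be the sums of [b], [c] over [Z/3].
   As [-1] is a power of 3 modulo 10, [D] is divisible by 3; as [-1] is a
   power of 2 modulo 5, [F] is even, hence so is [D], which is congruent to [F]
   modulo 2. So [D / 6] has norm 1 and [D] is concentrated at one position, 0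
   after a translation, where [b = 2] and [c = 0]. Elsewhere [b] sums to 0 over
   [Z/3], and, again by self-conjugacy of 3, its Fourier coefficient at a
   character of order 3 of [Z/3] is [3 z] with [z] over the Eisenstein integers
   of autocorrelation [4 delta]. There are 504 such [z]. If [z] is periodic of
   period 5 modulo 2, then so is the corresponding coefficient [g] of [c],
   which is congruent to [z] modulo 2, and the correlations of its first five
   values would all be even, which they are not. Otherwise [z] lives on the
   even or on the odd positions; then [g] is even on the other half, so that
   its correlations on this half are divisible by 4 at nonzero even shifts.
   Together with the 22 possible values of [F / 2] this leaves a search which
   finds no [g]. *)
Require Import Defs.
From HB Require Import structures.
From Stdlib Require Import ZArith Lia.
From mathcomp Require Import all_boot all_order all_algebra.
From mathcomp Require Import ssrZ.

Set Implicit Arguments.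
Unset Strict Implicit.
Unset Printing Implicit Defensive.

Section CirculantWeighing.

Local Open Scope Z_scope.

Local Arguments Z.mul : simpl never.
Local Arguments Z.add : simpl never.
Local Arguments Z.sub : simpl never.
Local Arguments Z.opp : simpl never.

(** * Cyclic and negacyclic autocorrelations over the Eisenstein integers *)

Local Notation eis := (Z * Z)%type.

Definition eadd (x y : eis) : eis := (x.1 + y.1, x.2 + y.2).
Definition eopp (x : eis) : eis := (- x.1, - x.2).

(* A pair [(p, q)] stands for [p + q w], where [w ^ 2 + w + 1 = 0], and
   [herm x y] for [x] times the conjugate of [y]. *)
Definition herm (x y : eis) : eis :=
  (x.1 * y.1 + x.2 * y.2 - x.1 * y.2, x.2 * y.1 - x.1 * y.2).

Fixpoint dot (l m : seq eis) : eis :=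
  match l, m with
  | x :: l', y :: m' => eadd (herm x y) (dot l' m')
  | _, _ => (0, 0)
  end.

(* Multiplication by the inverse of the indeterminate ['X] modulo ['X ^ n - 1]
   ([eps = false]) or ['X ^ n + 1] ([eps = true]). *)
Definition twist (eps : bool) (l : seq eis) : seq eis :=
  if l is x :: l' then rcons l' (if eps then eopp x else x) else [::].

Definition acorr eps (l : seq eis) (s : nat) : eis :=
  dot l (iter s (twist eps) l).

Definition eeq (x y : eis) : bool := (x.1 =? y.1) && (x.2 =? y.2).

Definition perfect eps (w : Z) (l : seq eis) : bool :=
  all (fun s => eeq (acorr eps l s) (if s == 0%N then w else 0, 0)) (iota 0 10).

(** * The finite search, split by the parity of positions *)

Definition evens (l : seq eis) : seq eis := [seq nth (0, 0) l i | i <- [:: 0; 2; 4; 6; 8]%N].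
Definition odds (l : seq eis) : seq eis := [seq nth (0, 0) l i | i <- [:: 1; 3; 5; 7; 9]%N].
Definition interleave (e o : seq eis) : seq eis :=
  flatten [seq [:: u.1; u.2] | u <- zip e o].

Definition weight (l : seq eis) : Z := foldr (fun x n => (herm x x).1 + n) 0 l.

Fixpoint tuples (T : Type) (os : seq (seq T)) : seq (seq T) :=
  if os is o :: os' then [seq x :: l | x <- o, l <- tuples os'] else [:: [::]].

(** Norms are nonnegative, so a prefix whose weight exceeds [w] is dropped at once. *)
Fixpoint wtuples (os : seq (seq eis)) (w : Z) : seq (seq eis) :=
  if os is o :: os' then
    flatten [seq (let w' := w - (herm x x).1 in
                  if w' <? 0 then [::] else map (cons x) (wtuples os' w')) | x <- o]
  else if w =? 0 then [:: [::]] else [::].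

(* The even shifts of an interleaving of [x] and [y] only involve the
   autocorrelations of [x] and [y]. *)
Definition complements eps w (os : seq (seq eis)) (x : seq eis) : seq (seq eis) :=
  let v1 := acorr eps x 1 in let v2 := acorr eps x 2 in
  [seq y <- wtuples os (w - weight x) |
    eeq (acorr eps y 1) (eopp v1) && eeq (acorr eps y 2) (eopp v2)].

Definition zero_opts : seq eis := [:: (0, 0)].

(** Position 0 is the head of the even half; after normalization both [z] and [f] vanish there. *)
Definition solutions eps w (o : seq eis) : seq (seq eis) :=
  let oe := zero_opts :: nseq 4 o in
  let oo := nseq 5 o in
  [seq z <- flatten [seq [seq interleave x y | y <- complements eps w oo x] | x <- tuples oe] |
    perfect eps w z].

(* At a position [t] of [Z/10], a list [a] holds the three values of the sequence
   over [t], then the three values over [t + 10].  With [b] and [c] their sums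
   and differences, a [local_datum] consists of
   [((b0 - b2) + (b1 - b2) w) / 3], [(c0 + c1 + c2) / 2] and
   [(c0 - c2) + (c1 - c2) w]; the divisions are exact for [admissible] lists. *)
Definition admissible (a : seq Z) : bool :=
  if a is [:: a0; a1; a2; a3; a4; a5] then
    [&& a0 + a3 + (a1 + a4) + (a2 + a5) =? 0,
        (a1 + a4 - (a2 + a5)) mod 3 =? 0 &
        (a0 - a3 + (a1 - a4) + (a2 - a5)) mod 2 =? 0]
  else false.

Definition local_datum (a : seq Z) : eis * eis * eis :=
  if a is [:: a0; a1; a2; a3; a4; a5] then
    (((a0 + a3 - (a2 + a5)) / 3, (a1 + a4 - (a2 + a5)) / 3),
     ((a0 - a3 + (a1 - a4) + (a2 - a5)) / 2, 0),
     (a0 - a3 - (a2 - a5), a1 - a4 - (a2 - a5)))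
  else ((0, 0), (0, 0), (0, 0)).

Definition local_data : seq (eis * eis * eis) :=
  Eval vm_compute in
  [seq local_datum a | a <- tuples (nseq 6 [:: -1; 0; 1]) & admissible a].

Definition zopts : seq eis := Eval vm_compute in undup [seq d.1.1 | d <- local_data].
Definition fopts : seq eis := Eval vm_compute in undup [seq d.1.2 | d <- local_data].
Definition gopts (z f : eis) : seq eis :=
  [seq d.2 | d <- local_data & eeq d.1.1 z && eeq d.1.2 f].

Definition zlist := Eval vm_compute in solutions false 4 zopts.
Definition flist := Eval vm_compute in solutions true 9 fopts.

Definition ediv n (x : eis) : bool := (x.1 mod n =? 0) && (x.2 mod n =? 0).

Definition periodic2 (z : seq eis) : bool :=
  all (fun i => ediv 2 (eadd (nth (0,0) z i) (nth (0,0) z (5 + i)))) (iota 0 5).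

Definition even_half (z : seq eis) := all (fun s => ediv 2 (acorr true (take 5 z) s)) (iota 0 5).

Definition gopts2 (z f : seq eis) : seq (seq eis) := [seq gopts u.1 u.2 | u <- zip z f].

(* When the entries of the other half are even, their autocorrelations are
   divisible by 4, hence so are those of this half at nonzero even shifts. *)
Definition xlist (zx fx : seq eis) (b : bool) : seq (seq eis) :=
  let os := gopts2 zx fx in
  let os := if b then zero_opts :: behead os else os in
  [seq x <- tuples os | ediv 4 (acorr true x 1) && ediv 4 (acorr true x 2)].

Definition eall0 := all (fun x => eeq x (0,0)).

(** Here [x] is the half of [g] on the positions where [z] lives and [y] is the other half; position
    0, where [g] vanishes, always belongs to the even one. The last [false] makes the computation
    itself confirm that every [z] tested here lives on one half. *)
Definition refute (z f : seq eis) : bool :=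
  if eall0 (odds z) then
    all (fun x => all (fun y => ~~ perfect true 36 (interleave x y))
       (complements true 36 (gopts2 (odds z) (odds f)) x))
       (xlist (evens z) (evens f) true)
  else if eall0 (evens z) then
    all (fun x => all (fun y => ~~ perfect true 36 (interleave y x))
       (complements true 36 (zero_opts :: behead (gopts2 (evens z) (evens f))) x))
       (xlist (odds z) (odds f) false)
  else false.

Definition final_check :=
  all (fun z => if periodic2 z then ~~ even_half z else all (refute z) flist) zlist.

(** * Completeness of the enumeration *)

Lemma eeqP x y : reflect (x = y) (eeq x y).
Proof.
case: x y => [a b] [c d]; rewrite /eeq /=.
apply: (iffP andP) => [[/Z.eqb_eq -> /Z.eqb_eq ->] | [-> ->]] //.
by split; apply/Z.eqb_eq.
Qed.

Lemma weight_ge0 x : 0 <= (herm x x).1.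
Proof. case: x => a b; rewrite /herm /=; nia. Qed.

Lemma mem_tuples (T : eqType) (os : seq (seq T)) l :
  all2 (fun x o => x \in o) l os -> l \in tuples os.
Proof.
elim: os l => [|o os IH] [|x l] //= /andP[xo /IH lo].
by apply/allpairsP; exists (x, l); split.
Qed.

Lemma mem_wtuples (os : seq (seq eis)) l :
  all2 (fun x o => x \in o) l os -> l \in wtuples os (weight l).
Proof.
elim: os l => [|o os IH] [|x l] //= /andP[xo /IH lo].
apply/flattenP; eexists; first by apply/mapP; exists x.
have -> : (herm x x).1 + weight l - (herm x x).1 = weight l by lia.
case: ifP => [/Z.ltb_lt|_]; last exact: map_f.
suff : 0 <= weight l by lia.
elim: (l) => //= y m; have := @weight_ge0 y; rewrite /=; lia.
Qed.

Lemma size10P (l : seq eis) : size l = 10%N ->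
  exists x0 x1 x2 x3 x4 x5 x6 x7 x8 x9, l = [:: x0; x1; x2; x3; x4; x5; x6; x7; x8; x9].
Proof.
case: l => [|x0 [|x1 [|x2 [|x3 [|x4 [|x5 [|x6 [|x7 [|x8 [|x9 [|]]]]]]]]]]] //= _.
by exists x0, x1, x2, x3, x4, x5, x6, x7, x8, x9.
Qed.

Ltac expand_list l hl :=
  move: l hl => _ /size10P [[? ?] [[? ?] [[? ?] [[? ?] [[? ?]
    [[? ?] [[? ?] [[? ?] [[? ?] [[? ?] ->]]]]]]]]]].

Ltac acorr_ring := cbv -[Z.add Z.mul Z.sub Z.opp]; congr pair; ring.

Lemma acorr_split eps l r : size l = 10%N -> (r < 3)%N ->
  acorr eps l r.*2 = eadd (acorr eps (evens l) r) (acorr eps (odds l) r).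
Proof.
move=> hl; expand_list l hl.
case: r => [|[|[|]]] // _; case: eps; acorr_ring.
Qed.

Lemma interleaveK l : size l = 10%N -> interleave (evens l) (odds l) = l.
Proof. by move=> hl; expand_list l hl. Qed.

Lemma perfectP eps w l : reflect
  (forall s, (s < 10)%N -> acorr eps l s = (if s == 0%N then w else 0, 0))
  (perfect eps w l).
Proof.
apply: (iffP allP) => [H s hs | H s].
  by apply/eeqP/H; rewrite mem_iota.
by rewrite mem_iota => /H ->; apply/eeqP.
Qed.

Lemma acorr0 eps l : (acorr eps l 0).1 = weight l.
Proof. by rewrite /acorr /=; elim: l => //= x l ->. Qed.

Lemma mem_complements eps w os l x y : size l = 10%N -> perfect eps w l ->
  (x = evens l /\ y = odds l) \/ (x = odds l /\ y = evens l) ->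
  all2 (fun x o => x \in o) y os -> y \in complements eps w os x.
Proof.
move=> hl /perfectP Hl Hxy hy.
have H r : (r < 3)%N ->
    eadd (acorr eps x r) (acorr eps y r) = (if r == 0%N then w else 0, 0).
  move=> hr; have := Hl r.*2; rewrite (acorr_split eps hl hr).
  have -> : (r.*2 < 10)%N by move: r hr => [|[|[|]]].
  rewrite double_eq0 => <- //; case: Hxy => [[-> ->]|[-> ->]] //.
  by rewrite /eadd; congr pair; lia.
rewrite mem_filter; apply/andP; split.
  apply/andP; split; apply/eeqP.
    by have := H 1%N isT; case: (acorr _ x _) (acorr _ y _) => ? ? [? ?] /= [? ?]; congr pair => /=; lia.
  by have := H 2%N isT; case: (acorr _ x _) (acorr _ y _) => ? ? [? ?] /= [? ?]; congr pair => /=; lia.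
have -> : w - weight x = weight y.
  by have /(f_equal fst) := H 0%N isT; rewrite /= !acorr0; lia.
exact: mem_wtuples.
Qed.

Lemma mem_solutions eps w o l : size l = 10%N -> perfect eps w l ->
  head (0, 0) l = (0, 0) -> all (mem o) (behead l) -> l \in solutions eps w o.
Proof.
move=> hl pl h0 ho; rewrite mem_filter pl andTb.
apply/flattenP; exists [seq interleave (evens l) y | y <- complements eps w (nseq 5 o) (evens l)].
  apply: map_f; apply: mem_tuples.
  move: (hl) h0 ho => /size10P [x0 [x1 [x2 [x3 [x4 [x5 [x6 [x7 [x8 [x9 ->]]]]]]]]]] /= ->.
  by rewrite inE eqxx; do ![case/andP => ?]; move=> _; do ?[apply/andP; split].
apply/mapP; exists (odds l); last by rewrite interleaveK.
apply: (mem_complements hl) => //; first by left.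
move: (hl) h0 ho => /size10P [x0 [x1 [x2 [x3 [x4 [x5 [x6 [x7 [x8 [x9 ->]]]]]]]]]] /= _.
by do ![case/andP => ?]; move=> _; do ?[apply/andP; split].
Qed.

(** * Congruences between autocorrelations *)

Definition cong n (x y : eis) : Prop := (n | x.1 - y.1) /\ (n | x.2 - y.2).

Lemma edivP n x : n <> 0 -> reflect (cong n x (0, 0)) (ediv n x).
Proof.
move=> n0; rewrite /ediv /cong /= !Z.sub_0_r.
apply: (iffP andP) => [[/Z.eqb_eq h1 /Z.eqb_eq h2]|[h1 h2]].
  by split; apply/Z.mod_divide.
by split; apply/Z.eqb_eq; apply/Z.mod_divide.
Qed.

Lemma cong_refl n x : cong n x x.
Proof. by split; rewrite Z.sub_diag; exact: Z.divide_0_r. Qed.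

Lemma cong_sym n x y : cong n x y -> cong n y x.
Proof. by case=> [[a ha] [b hb]]; split; [exists (- a) | exists (- b)]; lia. Qed.

Lemma cong_trans n x y z : cong n x y -> cong n y z -> cong n x z.
Proof.
by case=> [[a ha] [b hb]] [[c hc] [d hd]]; split; [exists (a + c) | exists (b + d)]; lia.
Qed.

Lemma cong_add n x y x' y' :
  cong n x y -> cong n x' y' -> cong n (eadd x x') (eadd y y').
Proof.
case=> [[a ha] [b hb]] [[c hc] [d hd]]; split; [exists (a + c) | exists (b + d)];
  rewrite /=; lia.
Qed.

Lemma cong_opp n x y : cong n x y -> cong n (eopp x) (eopp y).
Proof. by case=> [[a ha] [b hb]]; split; [exists (- a) | exists (- b)]; rewrite /=; lia. Qed.

Lemma cong_herm n x y x' y' :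
  cong n x y -> cong n x' y' -> cong n (herm x x') (herm y y').
Proof.
case: x y x' y' => [x1 x2] [y1 y2] [u1 u2] [v1 v2] /=.
case=> [[a /= ha] [b /= hb]] [[c /= hc] [d /= hd]].
have {ha}-> : x1 = y1 + a * n by lia.
have {hb}-> : x2 = y2 + b * n by lia.
have {hc}-> : u1 = v1 + c * n by lia.
have {hd}-> : u2 = v2 + d * n by lia.
split; rewrite /=.
- exists (a * v1 + y1 * c + a * c * n + b * v2 + y2 * d + b * d * n - (a * v2 + y1 * d + a * d * n)).
  ring.
- exists (b * v1 + y2 * c + b * c * n - (a * v2 + y1 * d + a * d * n)); ring.
Qed.

Lemma cong_dot n l m l' m' : List.Forall2 (cong n) l m ->
  List.Forall2 (cong n) l' m' -> cong n (dot l l') (dot m m').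
Proof.
move=> H; elim: H l' m' => [|x y l0 m0 hxy _ IH] l' m' [|x' y' l1 m1 h h'] /=;
  do ?exact: cong_refl.
by apply: cong_add; [exact: cong_herm | exact: IH].
Qed.

Lemma cong_twist n eps l m :
  List.Forall2 (cong n) l m -> List.Forall2 (cong n) (twist eps l) (twist eps m).
Proof.
case=> [|x y l0 m0 hxy h] /=; first by constructor.
rewrite -!cats1; apply: List.Forall2_app => //; constructor => //.
by case: eps => //; exact: cong_opp.
Qed.

Lemma cong_acorr n eps l m s : List.Forall2 (cong n) l m ->
  cong n (acorr eps l s) (acorr eps m s).
Proof.
move=> H; apply: cong_dot => //.
by elim: s => //= s IH; exact: cong_twist.
Qed.

(** Modulo 2 the sign in the twist disappears. *)
Lemma cong2_acorr eps eps' l s : cong 2 (acorr eps l s) (acorr eps' l s).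
Proof.
apply: cong_dot.
  by elim: l => [|x l IH]; constructor => //; exact: cong_refl.
elim: s => /= [|s IH].
  by elim: l => [|x l IH]; constructor => //; exact: cong_refl.
case: IH => [|x y l0 m0 hxy h] /=; first by constructor.
rewrite -!cats1; apply: List.Forall2_app => //; constructor => //.
have hopp u v : cong 2 u v -> cong 2 (eopp u) v.
  by case=> [[a ha] [b hb]]; split; [exists (- a - v.1) | exists (- b - v.2)]; rewrite /=; lia.
case: eps eps' {l m0 s l0 h} => [] [] //.
- exact: cong_opp.
- exact: hopp.
- by apply/cong_sym/hopp/cong_sym.
Qed.

Definition escale c (x : eis) : eis := (c * x.1, c * x.2).

Lemma herm_scale c x y : herm (escale c x) (escale c y) = escale (c * c) (herm x y).
Proof. by rewrite /herm /escale /=; congr pair; ring. Qed.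

Lemma acorr_scale c eps l s :
  acorr eps (map (escale c) l) s = escale (c * c) (acorr eps l s).
Proof.
have dotE (m m' : seq eis) : dot (map (escale c) m) (map (escale c) m') = escale (c * c) (dot m m').
  elim: m m' => [|x m IH] [|x' m'] /=; try by rewrite /escale /= Z.mul_0_r.
  by rewrite IH herm_scale /eadd /escale /=; congr pair; ring.
rewrite /acorr -dotE; congr dot; elim: s => //= s ->.
case: (iter _ _ _) => //= x m; rewrite map_rcons; case: eps => //.
by rewrite /eopp /escale /=; congr (rcons _ (_, _)); ring.
Qed.

(** * The computations, and why they exclude every [g] *)

Lemma zlistE : solutions false 4 zopts = zlist.
Proof. by vm_cast_no_check (erefl zlist). Qed.

Lemma flistE : solutions true 9 fopts = flist.
Proof. by vm_cast_no_check (erefl flist). Qed.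

Lemma final_checkE : final_check.
Proof. by vm_cast_no_check (erefl true). Qed.

(** Sums and differences of the same entries agree modulo 2, so [g] is congruent to [3 z], hence to
    [z]; in particular [g] is even where [z] vanishes. *)
Lemma local_dataP d : d \in local_data ->
  [/\ d.1.1 \in zopts, d.1.2 \in fopts, ediv 2 (eadd d.2 d.1.1) &
      d.1.1 = (0, 0) -> ediv 2 d.2].
Proof.
have /allP H : all (fun d : eis * eis * eis =>
    [&& d.1.1 \in zopts, d.1.2 \in fopts, ediv 2 (eadd d.2 d.1.1) &
        eeq d.1.1 (0, 0) ==> ediv 2 d.2]) local_data by vm_compute.
move=> /H /and4P[? ? ? /implyP h]; split => // d0.
by apply/h/eeqP.
Qed.

Lemma mem_gopts z f g : (z, f, g) \in local_data -> g \in gopts z f.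
Proof.
move=> H; apply/mapP; exists (z, f, g) => //.
rewrite mem_filter H andbT; apply/andP; split; exact/eeqP.
Qed.

Lemma ediv2_scale y : all (ediv 2) y -> exists y', y = map (escale 2) y'.
Proof.
elim: y => [|[a b] y IH]; first by exists [::].
case/andP=> /andP[/Z.eqb_eq /= ha /Z.eqb_eq /= hb] /IH[y' ->].
exists ((a / 2, b / 2) :: y'); rewrite /= /escale /=; congr ((_, _) :: _).
- by have := Z.div_mod a 2; lia.
- by have := Z.div_mod b 2; lia.
Qed.

Lemma ediv_acorr y r : all (ediv 2) y -> ediv 4 (acorr true y r).
Proof.
move=> /ediv2_scale[y' ->]; rewrite acorr_scale.
apply/edivP => //; split; rewrite /= Z.sub_0_r; exact: Z.divide_factor_l.
Qed.

Lemma size5P (l : seq eis) : size l = 5%N -> exists x0 x1 x2 x3 x4, l = [:: x0; x1; x2; x3; x4].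
Proof.
case: l => [|x0 [|x1 [|x2 [|x3 [|x4 [|]]]]]] //= _.
by exists x0, x1, x2, x3, x4.
Qed.

(* The sign of the twist makes the terms of the two correlations that are linear
   in [k] and carry a factor 2 cancel or double. *)
Lemma acorr_half g x k s : size x = 5%N -> size k = 5%N -> (s < 5)%N ->
  g = x ++ [seq eadd u.1 (escale 2 u.2) | u <- zip x k] ->
  cong 4 (eadd (acorr true g s) (acorr true g (s + 5))) (escale 2 (acorr true x s)).
Proof.
pose X := nth (0, 0) x; pose K := nth (0, 0) k.
pose term i := if (i + s < 5)%N then herm (eadd (X i) (K i)) (K (i + s)%N)
  else eopp (herm (K i) (eadd (X (i + s - 5)%N) (K (i + s - 5)%N))).
pose e := foldr (fun i => eadd (term i)) (0, 0) (iota 0 5).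
move=> hx hk hs ->.
set h := x ++ _; have -> : eadd (acorr true h s) (acorr true h (s + 5)) =
    eadd (escale 2 (acorr true x s)) (escale 4 e).
  rewrite {}/e {}/term {}/X {}/K {}/h.
  move: hx hk => /size5P[[? ?] [[? ?] [[? ?] [[? ?] [[? ?] ->]]]]].
  move=> /size5P[[? ?] [[? ?] [[? ?] [[? ?] [[? ?] ->]]]]].
  case: s hs => [|[|[|[|[|]]]]] // _; acorr_ring.
by split; [exists e.1 | exists e.2]; rewrite /=; ring.
Qed.

(** Since [g] is congruent to [z], it has period 5 modulo 2, which is the form required by
    [acorr_half]. The left side there is 36 or 0, a multiple of 4, so the correlations of the first
    half of [g] are even, and those of [z] agree with them modulo 2. *)
Lemma half_even z g : size z = 10%N -> size g = 10%N -> perfect true 36 g ->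
  periodic2 z -> (forall i, (i < 10)%N -> ediv 2 (eadd (nth (0, 0) g i) (nth (0, 0) z i))) ->
  even_half z.
Proof.
move=> hz hg /perfectP Hg /allP Hz Hgz.
have {}Hgz i : (i < 10)%N -> cong 2 (nth (0, 0) g i) (nth (0, 0) z i).
  move=> /Hgz /edivP [] // [a ha] [b hb]; rewrite /= in ha hb.
  by split; [exists (a - (nth (0, 0) z i).1) | exists (b - (nth (0, 0) z i).2)]; lia.
have Hk i : (i < 5)%N -> cong 2 (nth (0, 0) g (5 + i)) (nth (0, 0) g i).
  move=> hi; apply: cong_trans (Hgz _ _) _; first by rewrite (leq_add2l 5 i.+1 5).
  apply: cong_trans (cong_sym (Hgz _ (leq_trans hi _))) => //.
  have /Hz/edivP [] // : i \in iota 0 5 by rewrite mem_iota.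
  move=> [a ha] [b hb]; rewrite /= in ha hb.
  by split; [exists (a - (nth (0, 0) z i).1) | exists (b - (nth (0, 0) z i).2)]; rewrite /=; lia.
pose k := [seq (((nth (0, 0) g (5 + i)).1 - (nth (0, 0) g i).1) / 2,
                ((nth (0, 0) g (5 + i)).2 - (nth (0, 0) g i).2) / 2) | i <- iota 0 5].
have gE : g = take 5 g ++ [seq eadd u.1 (escale 2 u.2) | u <- zip (take 5 g) k].
  have kE i : (i < 5)%N -> nth (0, 0) g (5 + i) = eadd (nth (0, 0) g i) (escale 2 (nth (0, 0) k i)).
    move=> hi; rewrite (nth_map 0%N) ?size_iota // nth_iota // add0n.
    case: (Hk i hi) => -[a ha] [b hb].
    rewrite ha hb !Z.div_mul // /eadd /escale /= [LHS]surjective_pairing; congr pair; lia.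
  move: (kE 0%N isT) (kE 1%N isT) (kE 2%N isT) (kE 3%N isT) (kE 4%N isT).
  have /size5P[k0 [k1 [k2 [k3 [k4 ->]]]]] : size k = 5%N by [].
  move: (hg) => /size10P [x0 [x1 [x2 [x3 [x4 [x5 [x6 [x7 [x8 [x9 ->]]]]]]]]]] /=.
  by do 5!move=> ->.
apply/allP => s; rewrite mem_iota add0n => /andP[_ hs].
have ht : size (take 5 g) = 5%N by rewrite size_take hg.
have := acorr_half ht (erefl : size k = 5%N) hs gE.
rewrite !Hg ?(leq_trans hs) // ?(leq_add2r 5 s.+1 5) // addn_eq0 andbF => -[[a ha] [b hb]].
apply/edivP => //; apply: (@cong_trans _ _ (acorr true (take 5 g) s)).
  apply: cong_acorr; move: Hgz; clear -hz hg.
  move: (hg) => /size10P [x0 [x1 [x2 [x3 [x4 [x5 [x6 [x7 [x8 [x9 ->]]]]]]]]]].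
  move: (hz) => /size10P [y0 [y1 [y2 [y3 [y4 [y5 [y6 [y7 [y8 [y9 ->]]]]]]]]]] H /=.
  constructor; first exact: cong_sym (H 0%N isT).
  constructor; first exact: cong_sym (H 1%N isT).
  constructor; first exact: cong_sym (H 2%N isT).
  constructor; first exact: cong_sym (H 3%N isT).
  constructor; first exact: cong_sym (H 4%N isT).
  by constructor.
split; rewrite /= in ha hb *.
(* At shift 0, [36 - 2 x = 4 a] gives [x = 2 (9 - a)]. *)
- by exists ((if s == 0%N then 9 else 0) - a); case: (s == 0%N) ha; lia.
- by exists (- b); lia.
Qed.

Lemma all2_gopts z f g (n : nat) : size z = n -> size f = n -> size g = n ->
  (forall i, (i < n)%N -> (nth (0, 0) z i, nth (0, 0) f i, nth (0, 0) g i) \in local_data) ->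
  all2 (fun x o => x \in o) g (gopts2 z f).
Proof.
elim: n z f g => [|n IH] [|z0 z] [|f0 f] [|g0 g] //= [hz] [hf] [hg] H.
by rewrite (mem_gopts (H 0%N isT)) IH // => i hi; exact: (H i.+1).
Qed.

Lemma eall0_ediv z f g (n : nat) : size z = n -> size g = n -> eall0 z ->
  (forall i, (i < n)%N -> (nth (0, 0) z i, nth (0, 0) f i, nth (0, 0) g i) \in local_data) ->
  all (ediv 2) g.
Proof.
move=> hz hg /(all_nthP (0, 0)) Hz H; apply/(all_nthP (0, 0)) => i; rewrite hg => hi.
case: (local_dataP (H i hi)) => _ _ _ -> //=.
by apply/eeqP/Hz; rewrite hz.
Qed.

Lemma all2_head (T : eqType) (x0 : T) (l o : seq T) os :
  (0 < size l)%N -> head x0 l \in o -> all2 (fun x o => x \in o) l os ->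
  all2 (fun x o => x \in o) l (o :: behead os).
Proof. by case: l os => [|x l] [|o1 os] //= _ -> /andP[_ ->]. Qed.

(** The two halves of [g] are among the candidates tried by [refute], and interleaving them returns
    [g], which is perfect. *)
Lemma refuteP z f g : size z = 10%N -> size f = 10%N -> size g = 10%N ->
  perfect true 36 g -> nth (0, 0) g 0 = (0, 0) ->
  (forall i, (i < 10)%N -> (nth (0, 0) z i, nth (0, 0) f i, nth (0, 0) g i) \in local_data) ->
  ~~ refute z f.
Proof.
move=> hz hf hg pg g0 H.
have hs (l : seq eis) : size (evens l) = 5%N /\ size (odds l) = 5%N by [].
have He i : (i < 5)%N ->
    (nth (0, 0) (evens z) i, nth (0, 0) (evens f) i, nth (0, 0) (evens g) i) \in local_data.
  by case: i => [|[|[|[|[|]]]]] // _; exact: H.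
have Ho i : (i < 5)%N ->
    (nth (0, 0) (odds z) i, nth (0, 0) (odds f) i, nth (0, 0) (odds g) i) \in local_data.
  by case: i => [|[|[|[|[|]]]]] // _; exact: H.
have Ge := all2_gopts (proj1 (hs z)) (proj1 (hs f)) (proj1 (hs g)) He.
have Go := all2_gopts (proj2 (hs z)) (proj2 (hs f)) (proj2 (hs g)) Ho.
have Ge0 : all2 (fun x o => x \in o) (evens g) (zero_opts :: behead (gopts2 (evens z) (evens f))).
  by apply: (@all2_head _ (0, 0)) Ge => //; rewrite -[head _ _]/(nth (0, 0) g 0) g0.
have div4 x y : all (ediv 2) y ->
    (x = evens g /\ y = odds g) \/ (x = odds g /\ y = evens g) ->
    ediv 4 (acorr true x 1) && ediv 4 (acorr true x 2).
  move=> Hy Hxy; have Hr r : (0 < r < 3)%N -> ediv 4 (acorr true x r).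
    move=> /andP[r0 r3]; have := ediv_acorr r Hy => /edivP [] // [a ha] [b hb].
    have [Hr1 Hr2] : eadd (acorr true x r) (acorr true y r) = (0, 0).
      have /perfectP/(_ r.*2) := pg; rewrite acorr_split // double_eq0.
      have -> : (r.*2 < 10)%N by move: r r3 {r0 ha hb} => [|[|[|]]].
      rewrite (gtn_eqF r0) => <- //; case: Hxy => [[-> ->]|[-> ->]] //.
      by rewrite /eadd; congr pair; lia.
    rewrite /= in ha hb; apply/edivP => //; split; rewrite /=.
    - by exists (- a); lia.
    - by exists (- b); lia.
  by rewrite !Hr.
rewrite /refute; case: ifP => [z0|_].
  apply/negP => /allP /(_ (evens g)) X.
  have /X /allP /(_ (odds g)) : evens g \in xlist (evens z) (evens f) true.
    rewrite mem_filter (mem_tuples Ge0) andbT; apply: (@div4 _ (odds g)); last by left.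
    exact: (eall0_ediv (proj2 (hs z)) (proj2 (hs g)) z0 Ho).
  rewrite interleaveK // pg => Y; suff /Y : odds g \in complements true 36 (gopts2 (odds z) (odds f)) (evens g) by [].
  by apply: (mem_complements hg pg _ Go); left.
case: ifP => [z0|_] //.
apply/negP => /allP /(_ (odds g)) X.
have /X /allP /(_ (evens g)) : odds g \in xlist (odds z) (odds f) false.
  rewrite mem_filter (mem_tuples Go) andbT; apply: (@div4 _ (evens g)); last by right.
  exact: (eall0_ediv (proj1 (hs z)) (proj1 (hs g)) z0 He).
rewrite interleaveK // pg => Y.
suff /Y : evens g \in complements true 36 (zero_opts :: behead (gopts2 (evens z) (evens f))) (odds g) by [].
by apply: (mem_complements hg pg _ Ge0); right.
Qed.

Lemma no_local_data z f g : size z = 10%N -> size f = 10%N -> size g = 10%N ->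
  perfect false 4 z -> perfect true 9 f -> perfect true 36 g ->
  nth (0, 0) z 0 = (0, 0) -> nth (0, 0) f 0 = (0, 0) -> nth (0, 0) g 0 = (0, 0) ->
  (forall i, (i < 10)%N -> (nth (0, 0) z i, nth (0, 0) f i, nth (0, 0) g i) \in local_data) ->
  False.
Proof.
move=> hz hf hg pz pf pg z0 f0 g0 H.
have zl : z \in zlist.
  rewrite -zlistE; apply: mem_solutions => //.
  apply/allP => x /(nthP (0, 0))[i]; rewrite size_behead hz nth_behead => hi <-.
  by case: (local_dataP (H i.+1 hi)).
have fl : f \in flist.
  rewrite -flistE; apply: mem_solutions => //.
  apply/allP => x /(nthP (0, 0))[i]; rewrite size_behead hf nth_behead => hi <-.
  by case: (local_dataP (H i.+1 hi)).
have := final_checkE; rewrite /final_check => /allP/(_ z zl); case: ifP => [pz2|_].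
  apply/negP; rewrite negbK; apply: (half_even hz hg pg pz2) => i /H.
  by case/local_dataP.
by move/allP/(_ f fl); apply/negP; exact: refuteP pg g0 H.
Qed.

(** * Divisibility by 3 and by 2 through self-conjugacy *)

Definition real (l : seq eis) := all (fun x => x.2 =? 0) l.

Definition residues (n : nat) : seq eis := [seq (Z.of_nat i, 0) | i <- iota 0 n].

(* This holds for [n = 2, 3] since [-1] is a power of [n] modulo [5]: the
   involution of the semisimple algebra is then a power of the Frobenius. *)
Definition anisotropic n eps : bool :=
  all (fun r => all (fun s => ediv (Z.of_nat n) (acorr eps r s)) (iota 0 5) ==>
                all (ediv (Z.of_nat n)) r)
      (tuples (nseq 5 (residues n))).

(** Correlations modulo [n] depend only on the residues of the entries, so the finite check over
    residues decides. *)
Lemma anisotropicP n eps l : (0 < n)%N -> anisotropic n eps ->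
  size l = 5%N -> real l ->
  (forall s, (s < 5)%N -> ediv (Z.of_nat n) (acorr eps l s)) -> all (ediv (Z.of_nat n)) l.
Proof.
move=> n0 /allP Hn hl rl Hl; set N := Z.of_nat n in Hn Hl *.
have N1 : 0 < N by rewrite /N; move/ltP: n0; lia.
have N0 : N <> 0 by lia.
pose r := [seq (x.1 mod N, 0) | x <- l] : seq eis.
have lr : List.Forall2 (cong N) l r.
  rewrite /r; elim: (l) rl => [|[a b] m IH] /=; first by constructor.
  case/andP => /Z.eqb_eq /= -> /IH; constructor => //; split => /=.
    by exists (a / N); rewrite [X in X - _](Z.div_mod a N N0); ring.
  by exists 0.
have congdiv x y : cong N x y -> ediv N x -> ediv N y.
  move=> xy /(edivP _ N0) hx; apply/edivP => //; apply: cong_trans hx; exact: cong_sym.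
have rr : r \in tuples (nseq 5 (residues n)).
  apply: mem_tuples.
  have : all (mem (residues n)) r.
    apply/allP => x /mapP[y _ ->]; apply/mapP; exists (Z.to_nat (y.1 mod N)).
      rewrite mem_iota /= add0n; apply/ltP.
      by have [? ?] := Z.mod_pos_bound y.1 N N1; apply/Nat2Z.inj_lt; rewrite Z2Nat.id.
    by rewrite Z2Nat.id //; have [] := Z.mod_pos_bound y.1 N N1.
  have : size r = 5%N by rewrite size_map.
  by elim: (5)%N (r) => [|k IH] [|x m] //= [hm] /andP[-> hx]; exact: IH.
have /implyP/(_ _) := Hn r rr.
have -> : all (fun s => ediv N (acorr eps r s)) (iota 0 5).
  apply/allP => s; rewrite mem_iota => /Hl; apply: congdiv; exact: cong_acorr.
move=> /(_ isT); elim: lr => //= x y l0 m0 xy _ IH /andP[hy /IH ->]; rewrite andbT.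
by apply: congdiv hy; exact: cong_sym.
Qed.

Lemma anisotropic3 eps l : size l = 5%N -> real l ->
  (forall s, (s < 5)%N -> ediv 3 (acorr eps l s)) -> all (ediv 3) l.
Proof.
have H : anisotropic 3 eps by case: eps; vm_compute.
exact: (@anisotropicP 3 eps l isT H).
Qed.

Lemma anisotropic2 eps l : size l = 5%N -> real l ->
  (forall s, (s < 5)%N -> ediv 2 (acorr eps l s)) -> all (ediv 2) l.
Proof.
have H : anisotropic 2 eps by case: eps; vm_compute.
exact: (@anisotropicP 2 eps l isT H).
Qed.

(** [foldp] and [foldm] are the reductions modulo the two factors of
    [X ^ 10 - 1 = (X ^ 5 - 1) (X ^ 5 + 1)]. *)
Definition foldp (l : seq eis) : seq eis :=
  [seq eadd (nth (0, 0) l i) (nth (0, 0) l (5 + i)) | i <- iota 0 5].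
Definition foldm (l : seq eis) : seq eis :=
  [seq eadd (nth (0, 0) l i) (eopp (nth (0, 0) l (5 + i))) | i <- iota 0 5].

Lemma acorr_foldp l s : size l = 10%N -> (s < 5)%N ->
  acorr false (foldp l) s = eadd (acorr false l s) (acorr false l (5 + s)).
Proof.
move=> hl; expand_list l hl.
by case: s => [|[|[|[|[|]]]]] // _; acorr_ring.
Qed.

Lemma acorr_foldm l s : size l = 10%N -> (s < 5)%N ->
  acorr true (foldm l) s = eadd (acorr false l s) (eopp (acorr false l (5 + s))).
Proof.
move=> hl; expand_list l hl.
by case: s => [|[|[|[|[|]]]]] // _; acorr_ring.
Qed.

Lemma real_fold l : size l = 10%N -> real l -> real (foldp l) /\ real (foldm l).
Proof.
move=> hl; expand_list l hl; rewrite /real /= !andbT.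
by do ![case/andP => /Z.eqb_eq ->]; move/Z.eqb_eq => ->.
Qed.

Lemma edivD n x y : n <> 0 -> ediv n x -> ediv n y -> ediv n (eadd x y).
Proof.
move=> n0 /(edivP _ n0) hx /(edivP _ n0) hy; apply/edivP => //.
exact: (cong_add hx hy).
Qed.

Lemma edivN n x : n <> 0 -> ediv n x -> ediv n (eopp x).
Proof. move=> n0 /(edivP _ n0) hx; apply/edivP => //; exact: (cong_opp hx). Qed.

(** Anisotropy makes both reductions divisible by 3, and 2 is invertible modulo 3, so the list is
    recovered from them. *)
Lemma self_conj_div3 l : size l = 10%N -> real l ->
  (forall s, (s < 10)%N -> ediv 3 (acorr false l s)) -> all (ediv 3) l.
Proof.
move=> hl rl Hl; have [rp rm] := real_fold hl rl.
have Hs s : (s < 5)%N -> ediv 3 (acorr false l s) /\ ediv 3 (acorr false l (5 + s)).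
  by move=> hs; split; apply: Hl; [exact: leq_trans hs _ | rewrite (leq_add2l 5 s.+1 5)].
have Hp : all (ediv 3) (foldp l).
  apply: (@anisotropic3 false) => //.
  by move=> s hs; rewrite acorr_foldp //; case: (Hs s hs) => ? ?; apply: edivD.
have Hm : all (ediv 3) (foldm l).
  apply: (@anisotropic3 true) => //.
  by move=> s hs; rewrite acorr_foldm //; case: (Hs s hs) => ? ?; apply: edivD => //; apply: edivN.
have H2 x y : ediv 3 (eadd x y) -> ediv 3 (eadd x (eopp y)) -> ediv 3 x && ediv 3 y.
  move=> /edivP [] // [a ha] [b hb] /edivP [] // [c hc] [d hd]; rewrite /= in ha hb hc hd.
  (* The witnesses come from [x = 3 x - 2 x], where [2 x] is the sum of [x + y = 3 a] and
     [x - y = 3 c]; likewise for [y]. *)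
  by apply/andP; split; apply/edivP => //; split; rewrite /=;
    [exists (x.1 - a - c) | exists (x.2 - b - d) |
     exists (y.1 - a + c) | exists (y.2 - b + d)]; lia.
move: Hp Hm {Hl Hs rp rm}; move: (hl) => /size10P [x0 [x1 [x2 [x3 [x4 [x5 [x6 [x7 [x8 [x9 ->]]]]]]]]]] /=.
rewrite !andbT => /and5P[p0 p1 p2 p3 p4] /and5P[m0 m1 m2 m3 m4].
move: (H2 _ _ p0 m0) (H2 _ _ p1 m1) (H2 _ _ p2 m2) (H2 _ _ p3 m3) (H2 _ _ p4 m4).
by do 5![case/andP => -> ->].
Qed.

(** Modulo 2, [X ^ 10 + 1] is the square of [X ^ 5 + 1], so anisotropy is needed twice. Applied to
    the sum of the two halves it makes [l] periodic modulo 2; then [half_even], with [l] as both [z]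
    and [g], gives the even correlations needed to apply it to the first half. *)
Lemma self_conj_div2 l : size l = 10%N -> real l -> perfect true 36 l -> all (ediv 2) l.
Proof.
move=> hl rl pl; have [rp _] := real_fold hl rl.
have Hs s : (s < 10)%N -> ediv 2 (acorr false l s).
  move=> hs; apply/edivP => //; apply: cong_trans (cong2_acorr _ true _ _) _.
  move/perfectP: pl => /(_ s hs) ->; split => /=; last by exists 0.
  by case: (s == 0%N); [exists 18 | exists 0].
have Hp : all (ediv 2) (foldp l).
  apply: (@anisotropic2 false) => //.
  move=> s hs; rewrite acorr_foldp //; apply: edivD => //; apply: Hs.
    exact: leq_trans hs _.
  by rewrite (leq_add2l 5 s.+1 5).
have pl2 : periodic2 l by move: Hp; rewrite /foldp all_map.
have Hh : even_half l.
  apply: (half_even hl hl pl pl2) => i hi; apply/edivP => //.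
  by split; [exists (nth (0, 0) l i).1 | exists (nth (0, 0) l i).2]; rewrite /=; lia.
have Ht : all (ediv 2) (take 5 l).
  apply: (@anisotropic2 true) => //.
  - by rewrite size_take hl.
  - by move: rl; rewrite /real -[X in all _ X -> _](cat_take_drop 5) all_cat => /andP[].
  - by move=> s hs; apply: (allP Hh); rewrite mem_iota.
move: Ht Hp {pl rl rp Hs pl2 Hh}; move: (hl) => /size10P [x0 [x1 [x2 [x3 [x4 [x5 [x6 [x7 [x8 [x9 ->]]]]]]]]]] /=.
have H2 x y : ediv 2 x -> ediv 2 (eadd x y) -> ediv 2 y.
  move=> hx /edivD-/(_ (eopp x)) h; have := h _ (edivN _ hx).
  have -> : eadd (eadd x y) (eopp x) = y by rewrite [RHS]surjective_pairing /eadd /=; congr pair; lia.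
  exact.
rewrite !andbT => /and5P[h0 h1 h2 h3 h4] /and5P[p0 p1 p2 p3 p4].
by rewrite h0 h1 h2 h3 h4 (H2 _ _ h0 p0) (H2 _ _ h1 p1) (H2 _ _ h2 p2) (H2 _ _ h3 p3) (H2 _ _ h4 p4).
Qed.

(** * Integer sums and correlations of periodic functions *)

Fixpoint zsum (n : nat) (f : nat -> Z) : Z := if n is m.+1 then zsum m f + f m else 0.

Lemma eq_zsum n f g : (forall t, (t < n)%N -> f t = g t) -> zsum n f = zsum n g.
Proof. by elim: n => //= n IH H; rewrite H // IH // => t /ltnW; exact: H. Qed.

Lemma zsumD n f g : zsum n (fun t => f t + g t) = zsum n f + zsum n g.
Proof. elim: n => //= n ->; ring. Qed.

Lemma zsumZ n c f : zsum n (fun t => c * f t) = c * zsum n f.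
Proof. by elim: n => /= [|n ->]; ring. Qed.

Lemma zsum_split m n f : zsum (m + n) f = zsum m f + zsum n (fun t => f (m + t)%N).
Proof. by elim: n => [|n IH]; rewrite ?addn0 ?addnS /= ?IH; ring. Qed.

Lemma zsum_shift n m f : (forall t, f (t + n)%N = f t) ->
  zsum n (fun t => f (t + m)%N) = zsum n f.
Proof.
move=> Hf; elim: m => [|m IH]; first by apply: eq_zsum => t _; rewrite addn0.
rewrite -{}IH; have shift1 g : zsum n (fun t => g t.+1) = zsum n g + g n - g 0%N.
  by elim: (n) => /= [|k ->]; ring.
pose g u := f (u + m)%N; transitivity (zsum n (fun t => g t.+1)).
  by apply: eq_zsum => t _; rewrite /g addSnnS.
by rewrite shift1 /g add0n addnC Hf; ring.
Qed.

Lemma zsum_ge0 n f : (forall t, 0 <= f t) -> 0 <= zsum n f.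
Proof. by move=> Hf; elim: n => /= [|n IH]; [lia | have := Hf n; lia]. Qed.

Lemma le_zsum n f t : (forall t, 0 <= f t) -> (t < n)%N -> f t <= zsum n f.
Proof.
move=> Hf; elim: n => //= n IH; rewrite ltnS leq_eqVlt => /orP[/eqP ->|/IH].
  by have := @zsum_ge0 n f Hf; lia.
by have := Hf n; lia.
Qed.

(** A twist drops the first value and appends the one ten positions later, so iterated twists read
    off translates of [g]. *)
Lemma acorr_mkseq eps (g : nat -> eis) s :
  (forall t, g (t + 10)%N = if eps then eopp (g t) else g t) ->
  acorr eps (mkseq g 10) s =
  (zsum 10 (fun t => (herm (g t) (g (t + s)%N)).1),
   zsum 10 (fun t => (herm (g t) (g (t + s)%N)).2)).
Proof.
move=> Hg; rewrite /acorr.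
have -> : iter s (twist eps) (mkseq g 10) = mkseq (fun t => g (t + s)%N) 10.
  elim: s => [|s IH]; first by apply: eq_mkseq => t; rewrite addn0.
  rewrite iterS IH /= -Hg; rewrite !addSnnS !add0n.
  by rewrite [(s + 10)%N]addnC.
rewrite /dot /= /eadd /=; congr pair; ring.
Qed.

(** * Folding a sequence of period 60 *)

Section Perfect60.

Variable a : nat -> Z.
Hypothesis a_per : forall k, a (k + 60)%N = a k.
Hypothesis a_bound : forall k, -1 <= a k <= 1.
Hypothesis a_corr : forall s, zsum 60 (fun k => a k * a (k + s)%N) = if 60 %| s then 36 else 0.

(* The isomorphism of [Z/20 * Z/3] with [Z/60]. *)
Definition crt t j := a (21 * t + 40 * j)%N.

Lemma a_per_mul m k : a (k + 60 * m)%N = a k.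
Proof. by elim: m => [|m IH]; rewrite ?muln0 ?addn0 // mulnS addnA addnAC a_per IH. Qed.

Lemma crt_per20 t j : crt (t + 20) j = crt t j.
Proof. by rewrite /crt mulnDr addnAC (a_per_mul 7). Qed.

Lemma crt_per3 t j : crt t (j + 3) = crt t j.
Proof. by rewrite /crt mulnDr addnA (a_per_mul 2). Qed.

(** The shift by [(u, v)] is the shift by [21 * u + 40 * v] in [Z/60], and both sums run over the
    same 60 terms. Here 20 divides 40 and is coprime to 21, while 3 divides 21 and is coprime to
    40. *)
Lemma crt_corr u v :
  zsum 20 (fun t => crt t 0 * crt (t + u) v + crt t 1 * crt (t + u) (1 + v)
                    + crt t 2 * crt (t + u) (2 + v)) =
  if (20 %| u) && (3 %| v) then 36 else 0.
Proof.
pose g k := a k * a (k + (21 * u + 40 * v))%N.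
have gE t j : crt t j * crt (t + u) (j + v) = g (21 * t + 40 * j)%N.
  by rewrite /g /crt; congr (_ * a _); rewrite !mulnDr addnACA.
have gm k : g k = g (k %% 60)%N.
  by rewrite {1}(divn_eq k 60) addnC mulnC /g a_per_mul addnAC a_per_mul.
transitivity (zsum 20 (fun t => g ((21 * t) %% 60)%N + g ((21 * t + 40) %% 60)%N
                       + g ((21 * t + 80) %% 60)%N)).
  apply: eq_zsum => t _; rewrite -!gm !gE; congr (_ + _ + _).
  by have := gE t 0%N; rewrite add0n muln0 addn0.
transitivity (zsum 60 g).
  by move: g {gE gm} => g; cbv -[Z.add]; ring.
rewrite a_corr; congr (if _ then _ else _).
rewrite (@Gauss_dvd 20 3) //; congr andb.
  by rewrite dvdn_addl; [rewrite Gauss_dvdr | rewrite dvdn_mulr].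
by rewrite dvdn_addr; [rewrite Gauss_dvdr | rewrite dvdn_mulr].
Qed.

Section Fold.

Variable e : Z.
Hypothesis e_sq : e * e = 1.

(** For [e = 1] these are the sums [b], for [e = -1] the differences [c], over the subgroup of order
    2, generated by 10 in [Z/20]. *)
Definition fold t j := crt t j + e * crt (t + 10) j.

Lemma fold_per10 t j : fold (t + 10) j = e * fold t j.
Proof.
by rewrite /fold -addnA crt_per20 Z.mul_add_distr_l Z.mul_assoc e_sq; ring.
Qed.

Lemma fold_per3 t j : fold t (j + 3) = fold t j.
Proof. by rewrite /fold !crt_per3. Qed.

Definition corr3 u v t := fold t 0 * fold (t + u) v + fold t 1 * fold (t + u) (1 + v)
   + fold t 2 * fold (t + u) (2 + v).

(** Expanding gives the correlation of [crt] at [u] plus [e] times the one at [u + 10]; the latter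
    vanishes because [u + 10] lies strictly between 0 and 20. *)
Lemma fold_corr u v : (u < 10)%N -> (v < 3)%N ->
  zsum 10 (corr3 u v) = if (u == 0%N) && (v == 0%N) then 36 else 0.
Proof.
move=> hu hv.
pose Q u t := crt t 0 * crt (t + u) v + crt t 1 * crt (t + u) (1 + v)
                    + crt t 2 * crt (t + u) (2 + v).
have -> : zsum 10 (corr3 u v) = zsum 20 (Q u) + e * zsum 20 (Q (u + 10)%N).
  rewrite (zsum_split 10 10 (Q u)) (zsum_split 10 10 (Q (u + 10)%N)) -!zsumD -zsumZ -zsumD.
  apply: eq_zsum => t _; rewrite /corr3 /Q /fold.
  have h j : crt (10 + t + (u + 10)) j = crt (t + u) j.
    by rewrite -[RHS]crt_per20 [(10 + t)%N]addnC addnACA.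
  rewrite !h [(10 + t)%N]addnC ![(t + 10 + u)%N]addnAC ![(t + (u + 10))%N]addnA.
  have e2 x y : e * x * (e * y) = x * y.
    by transitivity (e * e * (x * y)); [ring | rewrite e_sq; ring].
  rewrite !(Z.mul_add_distr_l, Z.mul_add_distr_r) !e2; ring.
rewrite !crt_corr.
have -> : (20 %| u + 10)%N = false.
  apply/negP => /dvdn_leq; rewrite addn_gt0 orbT => /(_ isT).
  by rewrite leqNgt -[20%N]/(10 + 10)%N ltn_add2r hu.
have -> : (20 %| u)%N = (u == 0%N) by move: u hu; do 10![case=> //].
have -> : (3 %| v)%N = (v == 0%N) by move: v hv {Q}; do 3![case=> //].
by rewrite /= Z.mul_0_r Z.add_0_r.
Qed.

Definition total t := fold t 0 + fold t 1 + fold t 2.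
(** The Fourier coefficient [f0 + f1 w + f2 w ^ 2] over [Z/3], reduced by [w ^ 2 = - 1 - w]. *)
Definition omega_part t : eis := (fold t 0 - fold t 2, fold t 1 - fold t 2).

Lemma corr3E u t :
  [/\ corr3 u 0 t = fold t 0 * fold (t + u) 0 + fold t 1 * fold (t + u) 1 + fold t 2 * fold (t + u) 2,
      corr3 u 1 t = fold t 0 * fold (t + u) 1 + fold t 1 * fold (t + u) 2 + fold t 2 * fold (t + u) 0 &
      corr3 u 2 t = fold t 0 * fold (t + u) 2 + fold t 1 * fold (t + u) 0 + fold t 2 * fold (t + u) 1].
Proof.
rewrite /corr3; split => //.
  by rewrite -[(2 + 1)%N]/(0 + 3)%N fold_per3.
by rewrite -[(1 + 2)%N]/(0 + 3)%N -[(2 + 2)%N]/(1 + 3)%N !fold_per3.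
Qed.

Lemma total_corr u : (u < 10)%N ->
  zsum 10 (fun t => total t * total (t + u)) = if u == 0%N then 36 else 0.
Proof.
move=> hu; transitivity (zsum 10 (corr3 u 0) + zsum 10 (corr3 u 1) + zsum 10 (corr3 u 2)).
  rewrite -!zsumD; apply: eq_zsum => t _.
  by case: (corr3E u t) => -> -> ->; rewrite /total; ring.
by rewrite !fold_corr // !andbF andbT !Z.add_0_r.
Qed.

(** With [Cv] the sum of [corr3 u v], the correlation is [C0 + C2 w + C1 w ^ 2], that is
    [(C0 - C1) + (C2 - C1) w]. *)
Lemma omega_corr u : (u < 10)%N ->
  zsum 10 (fun t => (herm (omega_part t) (omega_part (t + u))).1) = (if u == 0%N then 36 else 0)
  /\ zsum 10 (fun t => (herm (omega_part t) (omega_part (t + u))).2) = 0.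
Proof.
move=> hu; split.
  transitivity (zsum 10 (corr3 u 0) + -1 * zsum 10 (corr3 u 1)).
    rewrite -!zsumZ -!zsumD; apply: eq_zsum => t _.
    by case: (corr3E u t) => -> -> _; rewrite /herm /=; ring.
  by rewrite !fold_corr // !andbF andbT !Z.add_0_r.
transitivity (zsum 10 (corr3 u 2) + -1 * zsum 10 (corr3 u 1)).
  rewrite -!zsumZ -!zsumD; apply: eq_zsum => t _.
  by case: (corr3E u t) => _ -> ->; rewrite /herm /=; ring.
by rewrite !fold_corr // !andbF.
Qed.

End Fold.

(** * Divisibility of the totals by 6 *)

Definition sgn (eps : bool) : Z := if eps then -1 else 1.

Lemma sgn_sq eps : sgn eps * sgn eps = 1.
Proof. by case: eps. Qed.

Lemma acorr_real eps (f : nat -> Z) s : (forall t, f (t + 10)%N = sgn eps * f t) ->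
  acorr eps (mkseq (fun t => (f t, 0)) 10) s = (zsum 10 (fun t => f t * f (t + s)%N), 0).
Proof.
move=> Hf; rewrite acorr_mkseq => [|t]; last first.
  by rewrite Hf /sgn; case: eps {Hf}; rewrite /eopp /=; congr pair; ring.
by congr pair; [apply: eq_zsum => t _; rewrite /herm /=; ring | rewrite /herm /=; ring].
Qed.

Lemma all_ediv_mkseq n (f : nat -> Z) t : n <> 0 -> (t < 10)%N ->
  all (ediv n) (mkseq (fun t => (f t, 0)) 10) -> (n | f t).
Proof.
move=> n0 ht /(all_nthP (0, 0)) /(_ t); rewrite size_mkseq nth_mkseq // => /(_ ht).
by move/(edivP _ n0) => [] /=; rewrite Z.sub_0_r.
Qed.

Lemma total_per eps t : total (sgn eps) (t + 10) = sgn eps * total (sgn eps) t.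
Proof. by rewrite /total !(fold_per10 (sgn_sq eps)); ring. Qed.

Lemma perfect_total eps : perfect eps 36 (mkseq (fun t => (total (sgn eps) t, 0)) 10).
Proof.
apply/perfectP => s hs; rewrite acorr_real; last exact: total_per.
by rewrite (total_corr (sgn_sq eps) hs).
Qed.

Lemma omega_per eps t : omega_part (sgn eps) (t + 10) =
  if eps then eopp (omega_part (sgn eps) t) else omega_part (sgn eps) t.
Proof.
rewrite /omega_part !(fold_per10 (sgn_sq eps)) /sgn.
by case: eps; rewrite /eopp /=; congr pair; ring.
Qed.

Lemma perfect_omega eps : perfect eps 36 (mkseq (omega_part (sgn eps)) 10).
Proof.
apply/perfectP => s hs; rewrite acorr_mkseq; last exact: omega_per.
by case: (omega_corr (sgn_sq eps) hs) => -> ->.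
Qed.

Lemma total_even t : (t < 10)%N -> (2 | total (-1) t).
Proof.
move=> ht; apply: (all_ediv_mkseq _ ht) => //.
apply: self_conj_div2 => //; exact: (perfect_total true).
Qed.

Lemma total_div3 t : (3 | total 1 t).
Proof.
have H u : (u < 10)%N -> (3 | total 1 u).
  move=> hu; apply: (all_ediv_mkseq _ hu) => //.
  apply: self_conj_div3 => // s hs; have /perfectP/(_ s hs) -> := perfect_total false.
  by case: (s == 0%N).
rewrite (divn_eq t 10) addnC; elim: (t %/ 10)%N => [|k IH].
  by rewrite mul0n addn0; apply: H; rewrite ltn_mod.
by rewrite mulSn addnCA addnC (total_per false) /= Z.mul_1_l.
Qed.

Lemma total_div6 t : (t < 10)%N -> (6 | total 1 t).
Proof.
move=> ht; case: (total_even ht) (total_div3 t) => [x hx] [y hy].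
have : total 1 t = total (-1) t + 2 * (crt (t + 10) 0 + crt (t + 10) 1 + crt (t + 10) 2).
  by rewrite /total /fold; ring.
(* For the total [T], the witness comes from [T = 3 T - 2 T]: evenness makes [3 T] a multiple of 6,
   and [T = 3 y] makes [2 T = 6 y]. *)
rewrite hx => E; exists (x + (crt (t + 10) 0 + crt (t + 10) 1 + crt (t + 10) 2) - y).
lia.
Qed.

Lemma total_sq : zsum 10 (fun t => total 1 t * total 1 t) = 36.
Proof.
rewrite -[RHS](total_corr (sgn_sq false) (isT : (0 < 10)%N)).
by apply: eq_zsum => t _; rewrite addn0.
Qed.

(** The squares of ten multiples of 6 add up to 36, so they cannot all vanish and none exceeds
    36. *)
Lemma exists_total6 : exists t, (t < 10)%N /\ (total 1 t = 6 \/ total 1 t = -6).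
Proof.
have sq0 t : 0 <= total 1 t * total 1 t by nia.
have [/hasP[t]|/hasPn H] := boolP (has (fun t => (total 1 t =? 6) || (total 1 t =? -6)) (iota 0 10)).
  rewrite mem_iota => ht /orP[] /Z.eqb_eq E; exists t; split => //; [by left | by right].
suff E : zsum 10 (fun t => total 1 t * total 1 t) = zsum 10 (fun=> 0) by rewrite total_sq in E.
apply: eq_zsum => t ht.
have := @le_zsum 10 (fun t => total 1 t * total 1 t) t sq0 ht; rewrite total_sq.
have /H : t \in iota 0 10 by rewrite mem_iota.
rewrite negb_or; case: (total_div6 ht) => d ->.
case/andP => /negbTE /Z.eqb_neq h1 /negbTE /Z.eqb_neq h2 h3.
have hd : -1 <= d <= 1 by nia.
by have -> : d = 0 by lia.
Qed.

(** * The case where the total is concentrated at position 0 *)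

Section Normalized.

Hypothesis total0 : total 1 0 = 6.

Lemma total_eq0 t : (0 < t < 10)%N -> total 1 t = 0.
Proof.
case/andP => t0 ht; have sq0 u : 0 <= total 1 u * total 1 u by nia.
have := total_sq; rewrite (zsum_split 1 9) [zsum 1 _]/= total0.
have ht1 : (t.-1 < 9)%N by rewrite -ltnS prednK.
have := @le_zsum 9 (fun t => total 1 (1 + t) * total 1 (1 + t)) t.-1 (fun t => sq0 _) ht1.
by rewrite add1n prednK // => h1 h2; nia.
Qed.

(** Six entries bounded by 1 add up to 6. *)
Lemma crt_0 j : (j < 3)%N -> crt 0 j = 1 /\ crt 10 j = 1.
Proof.
move: total0; rewrite /total /fold add0n.
have h t j' := a_bound (21 * t + 40 * j')%N; rewrite -?/(crt _ _) in h.
move: (h 0%N 0%N) (h 0%N 1%N) (h 0%N 2%N) (h 10%N 0%N) (h 10%N 1%N) (h 10%N 2%N).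
rewrite -!/(crt _ _); case: j => [|[|[|]]] // *; lia.
Qed.

Lemma omega0 : omega_part 1 0 = (0, 0) /\ omega_part (-1) 0 = (0, 0).
Proof.
rewrite /omega_part /fold add0n.
case: (@crt_0 0 isT) (@crt_0 1 isT) (@crt_0 2 isT) => [-> ->] [-> ->] [-> ->].
by [].
Qed.

(** Write [omega_part] as [p + q w]. Then [p + q] is the total minus three times an entry, so [p] is
    congruent to [- q] modulo 3, and it remains to apply [self_conj_div3] to the integer sequence
    [q]. *)
Lemma omega_div3 t : (t < 10)%N -> (3 | (omega_part 1 t).1) /\ (3 | (omega_part 1 t).2).
Proof.
pose q t := (omega_part 1 t).2; pose m t := fold 1 t 2 - total 1 t / 3.
have pE u : (omega_part 1 u).1 = - q u - 3 * m u.
  rewrite /q /m; case: (total_div3 u) => d E.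
  rewrite E Z.div_mul //; move: E; rewrite /total /omega_part /=; lia.
have Hq u : (u < 10)%N -> (3 | q u).
  move=> hu; apply: (all_ediv_mkseq _ hu) => //.
  apply: self_conj_div3 => // s hs; rewrite (@acorr_real false) => [|v]; last first.
    by rewrite /q (omega_per false) /= Z.mul_1_l.
  have [h1 h2] := @omega_corr 1 erefl s hs.
  (* In the sum of the two components of the correlation, after [p = - q - 3 m], the products of
     [q v] with [m (v + s)] cancel and all other terms in [m] are multiples of 9. As 9 divides 36,
     [S] is a multiple of 3. *)
  set S := zsum _ _; pose W := zsum 10 (fun v => m v * q (v + s)%N + m v * m (v + s)%N).
  have : 3 * S + 9 * W = if s == 0%N then 36 else 0.
    rewrite -h1 -[RHS]Z.add_0_r -h2 /S /W -!zsumZ -!zsumD; apply: eq_zsum => v _.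
    by rewrite /herm !pE -!/(q _) /=; ring.
  move=> E; apply/edivP => //; split; last by exists 0.
  exists ((if s == 0%N then 4 else 0) - W); rewrite /=; move: E; case: (s == 0%N); lia.
move=> ht; split; last exact: Hq.
by rewrite pE; case: (Hq t ht) => d ->; exists (- d - m t); ring.
Qed.

Lemma normalized_false : False.
Proof.
pose z t := ((omega_part 1 t).1 / 3, (omega_part 1 t).2 / 3).
pose f t := total (-1) t / 2.
have zE : mkseq (omega_part 1) 10 = map (escale 3) (mkseq z 10).
  rewrite /mkseq -map_comp; apply/eq_in_map => t; rewrite mem_iota => ht.
  case: (omega_div3 ht) => -[x hx] [y hy].
  have E : omega_part 1 t = (x * 3, y * 3) by rewrite -hx -hy -surjective_pairing.
  by rewrite /comp /z E /escale /= !Z.div_mul //; congr pair; ring.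
have fE : mkseq (fun t => (total (-1) t, 0)) 10 = map (escale 2) (mkseq (fun t => (f t, 0)) 10).
  rewrite /mkseq -map_comp; apply/eq_in_map => t; rewrite mem_iota => ht.
  case: (total_even ht) => x hx.
  by rewrite /f /escale /= hx Z.div_mul //; congr pair; ring.
have pz : perfect false 4 (mkseq z 10).
  apply/perfectP => s hs; have /perfectP/(_ s hs) := perfect_omega false.
  rewrite /sgn zE acorr_scale; case: (acorr _ _ _) => x y [/= hx hy].
  by congr pair; [move: hx; case: (s == 0%N) |]; lia.
have pf : perfect true 9 (mkseq (fun t => (f t, 0)) 10).
  apply/perfectP => s hs; have /perfectP/(_ s hs) := perfect_total true.
  rewrite /sgn fE acorr_scale; case: (acorr _ _ _) => x y [/= hx hy].
  by congr pair; [move: hx; case: (s == 0%N) |]; lia.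
have z0 : z 0%N = (0, 0) by rewrite /z; case: omega0 => ->.
have f0 : f 0%N = 0.
  rewrite /f /total /fold add0n.
  by case: (@crt_0 0 isT) (@crt_0 1 isT) (@crt_0 2 isT) => [-> ->] [-> ->] [-> ->].
have g0 : omega_part (sgn true) 0 = (0, 0) by case: omega0.
apply: (no_local_data _ _ _ pz pf (perfect_omega true) _ _ _ _); rewrite ?size_mkseq //.
  by rewrite nth_mkseq // f0.
move=> t ht; rewrite !nth_mkseq //; case: (posnP t) => [->|t0].
  (* At position 0 the six entries are all 1, which is not [admissible]; the zero datum is in
     [local_data] anyway, through the zero list. *)
  by rewrite z0 f0 g0; vm_compute.
pose l := [:: crt t 0; crt t 1; crt t 2; crt (t + 10) 0; crt (t + 10) 1; crt (t + 10) 2].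
have -> : (z t, (f t, 0), omega_part (sgn true) t) = local_datum l.
  rewrite /z /f /omega_part /total /fold /local_datum /l /sgn !Z.mul_1_l.
  congr ((_ / _, _ / _), (_ / _, _), (_, _)); ring.
have -> : local_data = [seq local_datum a | a <- tuples (nseq 6 [:: -1; 0; 1]) & admissible a].
  by vm_compute.
apply: map_f; rewrite mem_filter mem_tuples; last first.
  have h u j : crt u j \in [:: -1; 0; 1].
    have := a_bound (21 * u + 40 * j)%N; rewrite -/(crt u j) !inE.
    by move: (crt u j) => x hx; have [->|[->|->]] : x = -1 \/ x = 0 \/ x = 1 by lia.
  by rewrite /= !h.
rewrite andbT; apply/and3P; split; apply/Z.eqb_eq.
- have := @total_eq0 t; rewrite t0 ht => /(_ isT) <-; rewrite /total /fold; ring.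
- apply/Z.mod_divide => //; case: (omega_div3 ht) => _; rewrite /omega_part /fold !Z.mul_1_l; exact.
- apply/Z.mod_divide => //; have := total_even ht; rewrite /total /fold.
  by congr (_ | _)%Z; ring.
Qed.

End Normalized.
End Perfect60.

Lemma no_perfect60 a : (forall k, a (k + 60)%N = a k) -> (forall k, -1 <= a k <= 1) ->
  (forall s, zsum 60 (fun k => a k * a (k + s)%N) = if (60 %| s)%N then 36 else 0) -> False.
Proof.
move=> a_per a_bound a_corr.
have [t [_ Ht]] := exists_total6 a_per a_corr.
have [e [e1 He]] : exists e, (e = 1 \/ e = -1) /\ e * total a 1 t = 6.
  by case: Ht => ->; [exists 1 | exists (-1)]; split; auto.
have e2 : e * e = 1 by case: e1 => ->.
(* The shift by [21 * t] moves position [t] of [Z/20] to 0 and fixes the coordinate in [Z/3]; the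
   sign [e] turns a total of -6 into 6. *)
apply: (@normalized_false (fun k => e * a (k + 21 * t)%N)).
- by move=> k; rewrite addnAC a_per.
- by move=> k; have := a_bound (k + 21 * t)%N; case: e1 => ->; lia.
- move=> s; rewrite -a_corr -[RHS](@zsum_shift _ (21 * t)) => [|k]; last first.
    by rewrite [(k + 60 + s)%N]addnAC !a_per.
  apply: eq_zsum => k _; rewrite [(k + 21 * t + s)%N]addnAC.
  by transitivity (e * e * (a (k + 21 * t)%N * a (k + s + 21 * t)%N)); [ring | rewrite e2; ring].
have E u j : crt (fun k => e * a (k + 21 * t)%N) u j = e * crt a (t + u) j.
  by rewrite /crt addnAC -mulnDr [(u + t)%N]addnC.
by rewrite -He /total /fold !E addn0 add0n; ring.
Qed.

(** * From circulant matrices to periodic sequences *)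

Lemma neg_mod_eq0 n s : (0 < n)%N -> ((n - s %% n) %% n == 0)%N = (n %| s)%N.
Proof.
move=> n0; rewrite /dvdn; have := ltn_pmod s n0.
case: (s %% n)%N => [|m] hm; first by rewrite subn0 modnn eqxx.
by rewrite modn_small ?subn_eq0 ?ltn_subrL // leqNgt hm.
Qed.

Lemma sum_zsum n (f : nat -> Z) : (\sum_(i < n) f i)%R = zsum n f.
Proof. by elim: n => [|n IH]; rewrite ?big_ord0 // big_ord_recr /= IH. Qed.

Lemma circulant_row (W : 'M[int]_60) (i k : nat) : @circulant 59 W -> (i < 60)%N ->
  W (inord i) (inord ((i + k) %% 60)) = W ord0 (inord (k %% 60)).
Proof.
move=> Wc; elim: i => [|i IH] hi.
  by rewrite add0n; congr (W _ _); apply: val_inj; rewrite /= inordK.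
rewrite -IH ?(ltnW hi) // -(Wc (inord i)) ?inordK ?(ltnW hi) //; last exact: ltn_pmod.
by congr (W _ (inord _)); rewrite -[in RHS]addn1 modnDml addn1 addSn.
Qed.

End CirculantWeighing.

Local Open Scope ring_scope.

Theorem mainTheorem3 :
  ~ (exists W : 'M[int]_60, @weighing_matrix 60 36 W /\ @circulant 59 W).
Proof.
case=> W [[_ [Wentry Wsq]] Wc].
pose w k := W ord0 (inord (k %% 60)).
apply: (@no_perfect60 (fun k => Z_of_int (w k))).
- by move=> k; rewrite /w modnDr.
- by move=> k; have := Wentry ord0 (inord (k %% 60)); rewrite -/(w k) !inE => /or3P[] /eqP ->.
move=> s; rewrite -(sum_zsum 60 (fun k => (Z_of_int (w k) * Z_of_int (w (k + s)%N)))).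
(* For [i = - s] modulo 60, row [i] has entry [w (j + s)] in column [j], so its product with row 0
   is the correlation at shift [s]. *)
pose i := ((60 - s %% 60) %% 60)%N.
have hi : (i < 60)%N by rewrite ltn_mod.
have si : ((i + s) %% 60 = 0)%N.
  by rewrite /i modnDml -modnDmr subnK ?modnn // ltnW // ltn_mod.
have /matrixP/(_ ord0 (inord i)) := Wsq; rewrite !mxE => E.
transitivity (Z_of_int (\sum_j W ord0 j * W (inord i) j)).
  rewrite GRing.rmorph_sum; apply: eq_bigr => j _; rewrite GRing.rmorphM; congr (_ * _).
    by rewrite /w modn_small // inord_val.
  rewrite /w -(circulant_row (j + s) Wc hi); congr (Z_of_int (W _ _)).
  by apply: val_inj; rewrite /= inordK ?ltn_mod // addnCA -modnDmr si addn0 modn_small.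
rewrite (_ : \sum_j _ = (36%:R *+ (ord0 == inord i :> 'I_60))); last first.
  by rewrite -E; apply: eq_bigr => j _; rewrite mxE.
have -> : (ord0 == inord i :> 'I_60) = (60 %| s)%N.
  by rewrite -val_eqE /= inordK // eq_sym -(@neg_mod_eq0 60 s isT).
by case: (60 %| s)%N.
Qed.
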